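(* Let $G=(V,E)$ be a finite connected cubic graph. Then the following are equivalent: (i) $\mathrm{Fl}\,G$ satisfies the Jordan–Dedekind condition; (ii) $\mathrm{c\text{-}rk}\,G\le3$, or $G$ is sober and every edge of $G$ lies in some square; (iii) $\mathrm{c\text{-}rk}\,G\le3$, or $G\cong K_4$, or $G\cong H_n$ for some $n\ge3$, or $G\cong\tilde H_n$ for some $n\ge4$.
   Context: Graphs are finite, undirected, without loops or multiple edges; cubic means all degrees are 3; a square is a cycle of length 4. $\mathrm{St}(v)$ is the set of neighbours of $v$, $\mathrm{St}(W)=\bigcap_{w\in W}\mathrm{St}(w)$ with $\mathrm{St}(\emptyset)=V$, $\mathrm{Fl}\,G=\{\mathrm{St}(W)\mid W\subseteq V\}$ ordered by inclusion. A lattice satisfies the Jordan–Dedekind condition if all maximal chains have the same length. $G$ is sober if $v\mapsto\mathrm{St}(v)$ is injective. $\mathrm{c\text{-}rk}\,G$ is the maximum number of independent columns of the $V\times V$ boolean matrix $A^c$ (entry $0$ if $\{i,j\}\in E$, else $1$), where vectors over the superboolean semiring $\{0,1,1^\nu\}$ (with $1+1=1^\nu$, $1^\nu+x=1^\nu$, $0+x=x$, $1\cdot1=1$, $1\cdot1^\nu=1^\nu\cdot1^\nu=1^\nu$, $0\cdot x=0$) are dependent if some nonzero $\{0,1\}$-combination of them has all coordinates in $\{0,1^\nu\}$. $H_n$ has vertices $v_1,\dots,v_n,w_1,\dots,w_n$ and edges $v_iv_{i+1}$, $w_iw_{i+1}$ ($i=1,\dots,n-1$), $v_nv_1$, $w_nw_1$,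 and $v_iw_i$ ($i=1,\dots,n$). $\tilde H_n$ has the same vertices and edges $v_iv_{i+1}$, $w_iw_{i+1}$ ($i=1,\dots,n-1$), $v_iw_i$ ($i=1,\dots,n$), $v_nw_1$ and $w_nv_1$. *)

(* Defs.v *)
From HB Require Import structures.
From mathcomp Require Import all_boot all_order all_algebra.

Set Implicit Arguments.
Unset Strict Implicit.
Unset Printing Implicit Defensive.

Import GRing.Theory.

(** A graph on the finite type [V] is a symmetric irreflexive [e : rel V]. *)

Section Graphs.

Variables (V : finType) (e : rel V).

Definition star (v : V) : {set V} := [set w | e v w].

Definition cubic : Prop := forall v, #|star v| = 3.

Definition connected : Prop := forall x y, connect e x y.

(** The empty intersection is [setT], so that [starI set0 = setT]. *)
Definition starI (W : {set V}) : {set V} := \bigcap_(w in W) star w.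

Definition Fl : {set {set V}} := [set starI W | W : {set V}].

Definition sober : Prop := injective star.

(** A square containing the edge [xy] can be listed starting with [x], [y];
    [ucycle] makes the four vertices distinct. *)
Definition edge_in_square (x y : V) : Prop :=
  exists z t, ucycle e [:: x; y; z; t].

Definition every_edge_in_square : Prop :=
  forall x y, e x y -> edge_in_square x y.

End Graphs.

Section JordanDedekind.

Variables (T : finType) (F : {set {set T}}).

Definition chain (C : {set {set T}}) : bool :=
  (C \subset F) &&
  [forall X in C, forall Y in C, (X \subset Y) || (Y \subset X)].

Definition maximal_chain (C : {set {set T}}) : bool := maxset chain C.

Definition chain_length (C : {set {set T}}) : nat := #|C|.-1.

Definition jordan_dedekind : Prop :=
  forall C D, maximal_chain C -> maximal_chain D ->
    chain_length C = chain_length D.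

End JordanDedekind.

(** [SBnu] is the element written 1^nu. *)
Inductive superbool : Type := SB0 | SB1 | SBnu.

Definition superbool_code (x : superbool) : option bool :=
  match x with SB0 => None | SB1 => Some false | SBnu => Some true end.

Definition superbool_decode (x : option bool) : superbool :=
  match x with None => SB0 | Some false => SB1 | Some true => SBnu end.

Lemma superbool_codeK : cancel superbool_code superbool_decode.
Proof. by case. Qed.

HB.instance Definition _ :=
  Countable.copy superbool (can_type superbool_codeK).
HB.instance Definition _ : isFinite superbool := CanIsFinite superbool_codeK.

Definition sb_add (x y : superbool) : superbool :=
  match x, y with
  | SB0, z | z, SB0 => z
  | _, _ => SBnu
  end.

Definition sb_mul (x y : superbool) : superbool :=
  match x, y with
  | SB0, _ | _, SB0 => SB0
  | SB1, SB1 => SB1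
  | _, _ => SBnu
  end.

Lemma sb_addA : associative sb_add. Proof. by do 3![case]. Qed.
Lemma sb_addC : commutative sb_add. Proof. by do 2![case]. Qed.
Lemma sb_add0 : left_id SB0 sb_add. Proof. by case. Qed.

HB.instance Definition _ :=
  GRing.isNmodule.Build superbool sb_addA sb_addC sb_add0.

Lemma sb_mulA : associative sb_mul. Proof. by do 3![case]. Qed.
Lemma sb_mulC : commutative sb_mul. Proof. by do 2![case]. Qed.
Lemma sb_mul1 : left_id SB1 sb_mul. Proof. by case. Qed.
Lemma sb_mul0 : left_zero SB0 sb_mul. Proof. by case. Qed.
Lemma sb_mulDl : left_distributive sb_mul sb_add.
Proof. by do 3![case]. Qed.
Lemma sb_1neq0 : SB1 != SB0. Proof. by []. Qed.

HB.instance Definition _ := GRing.Nmodule_isComNzSemiRing.Build superbool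
  sb_mulA sb_mulC sb_mul1 sb_mulDl sb_mul0 sb_1neq0.

Section Rank.

Variables (I J : finType) (M : I -> J -> superbool).

Local Open Scope ring_scope.

(** Columns are taken as an indexed family: two equal columns are
    dependent.  The coefficient [(c j)%:R] is 0 or 1. *)
Definition dependent_columns (W : {set J}) : bool :=
  [exists c : {ffun J -> bool}, [exists j in W, c j] &&
     [forall i, (\sum_(j in W) (c j)%:R * M i j) \in [:: 0; SBnu]]].

Definition column_rank : nat :=
  (\max_(W : {set J} | ~~ dependent_columns W) #|W|)%N.

End Rank.

Definition compl_adj (V : finType) (e : rel V) (i j : V) : superbool :=
  if e i j then SB0 else SB1.

Definition c_rk (V : finType) (e : rel V) : nat := column_rank (compl_adj e).

Definition graph_iso (V U : finType) (e : rel V) (e' : rel U) : Prop :=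
  exists2 f : V -> U, bijective f & forall x y, e' (f x) (f y) = e x y.

Definition complete_graph (n : nat) : rel 'I_n := [rel i j | i != j].
Arguments complete_graph n : clear implicits.

Definition sym_closure (T : Type) (r : rel T) : rel T :=
  [rel x y | r x y || r y x].

Section Ladders.

Variable n : nat.

Implicit Types x y : bool * 'I_n.

(** [(false, i)] is v_(i+1) and [(true, i)] is w_(i+1). *)

Definition rail x y : bool := (x.1 == y.1) && (y.2 == x.2.+1 :> nat).

Definition rung x y : bool := [&& ~~ x.1, y.1 & x.2 == y.2].

(** v_n v_1 and w_n w_1, or v_n w_1 and w_n v_1 if [twist] holds. *)
Definition closing (twist : bool) x y : bool :=
  [&& y.1 == x.1 (+) twist, x.2.+1 == n & y.2 == 0 :> nat].

Definition ladder (twist : bool) : rel (bool * 'I_n) :=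
  sym_closure (fun x y => [|| rail x y, rung x y | closing twist x y]).

Definition Hgraph : rel (bool * 'I_n) := ladder false.

Definition Htgraph : rel (bool * 'I_n) := ladder true.

End Ladders.
Arguments Hgraph n : clear implicits.
Arguments Htgraph n : clear implicits.

(* Main.v *)
Require Import Defs.
From mathcomp Require Import all_boot all_order all_algebra.
From mathcomp Require Import zify.

Set Implicit Arguments.
Unset Strict Implicit.
Unset Printing Implicit Defensive.

Import GRing.Theory.

(** The c-rank is the length of a longest chain of flats.  Flats of a cubic
    graph are [V], stars and sets of at most two vertices, so chains of flats
    have length at most 4.  If the c-rank is 4, the Jordan-Dedekind condition
    says that flats of all sizes 0, 1, 2, 3 can be inserted into every chain.
    Inserting a pair below a star and a singleton below that pair gives
    soberness; inserting a pair between a singleton [{a}] and [St(v)] gives a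
    square through [av].  If the c-rank is at most 3, the only possible
    obstruction is a maximal chain [V > St(v) > 0]; it forces distinct stars
    to be disjoint, a property that spreads along the edges of the graph.

    For the classification, take a maximal ladder strip [v_0 ... v_(n-1)],
    [w_0 ... w_(n-1)], starting from a square.  Its inner vertices already have
    three neighbours in the strip.  If an edge leaves the strip at an end, the
    square through that edge allows one to prolong the strip.  So a maximal
    strip covers the graph, and the two missing edges at its ends leave only
    [K_4], the ladders [H_n] and the twisted ladders. *)

(** * Rank and chains of flats *)

Section Rank.

Variables (V : finType) (e : rel V).
Hypothesis e_sym : symmetric e.

Implicit Types (C D : {set {set V}}) (W X Y : {set V}).

Lemma in_star x y : (y \in star e x) = e x y.
Proof. by rewrite inE. Qed.

Lemma starIP W x : reflect (forall w, w \in W -> e w x) (x \in starI e W).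
Proof.
by apply: (iffP bigcapP) => h w /h; rewrite in_star.
Qed.

Lemma starI_Fl W : starI e W \in Fl e.
Proof. exact: imset_f. Qed.

Lemma star_Fl v : star e v \in Fl e.
Proof. by have := starI_Fl [set v]; rewrite /starI big_set1. Qed.

Lemma setT_Fl : setT \in Fl e.
Proof. by have := starI_Fl set0; rewrite /starI big_set0. Qed.

Lemma starIS W W' : W' \subset W -> starI e W \subset starI e W'.
Proof.
by move=> /subsetP sW; apply/subsetP=> x /starIP h; apply/starIP=> w /sW/h.
Qed.

Lemma starI_sub W w : w \in W -> starI e W \subset star e w.
Proof. by move=> wW; apply/subsetP=> x /starIP/(_ w wW); rewrite in_star. Qed.

Lemma natr_superbool n :
  ((n%:R : superbool) \in [:: 0; SBnu] = (n != 1))%R.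
Proof.
case: n => [|[|n]] //; elim: n => [|n IHn] //.
rewrite mulrS; have: (n.+2%:R : superbool)%R = SBnu.
  by rewrite mulrS; elim: n {IHn} => // n IHn; rewrite mulrS IHn.
by move->.
Qed.

(** The combination with support [X] has at row [i] a sum of as many ones as [X] has elements
    outside [star e i]. It avoids 0 and [SBnu] exactly when that number is 1. *)
Lemma independentP W :
  reflect (forall X, X \subset W -> X != set0 ->
             exists i, #|X :\: star e i| = 1)
          (~~ dependent_columns (compl_adj e) W).
Proof.
have sumE (c : {ffun V -> bool}) i :
    (\sum_(j in W) (c j)%:R * compl_adj e i j)%R
      = (#|[set j in W | c j] :\: star e i|%:R : superbool)%R.
  rewrite -sumr_const (bigID (fun j => c j && ~~ e i j)) /= [X in (_ + X)%R]big1.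
    rewrite GRing.addr0; apply: eq_big => j.
      by rewrite !inE andbA andbC.
    by case/and3P=> _ cj; rewrite /compl_adj; case: (e i j); rewrite ?cj.
  by move=> j /andP[_]; rewrite /compl_adj; case: (c j); case: (e i j).
apply: (iffP idP) => [ind X sXW /set0Pn[x xX] | h].
  suff /existsP[i /eqP hi] : [exists i, #|X :\: star e i| == 1] by exists i.
  apply: contraNT ind => /existsPn no; apply/existsP;
    exists [ffun j => j \in X]; apply/andP; split.
    by apply/existsP; exists x; rewrite ffunE (subsetP sXW) xX.
  apply/forallP=> i; rewrite sumE natr_superbool; move: (no i).
  congr (#|pred_of_set (_ :\: _)| != 1); apply/setP=> j; rewrite inE ffunE.
  by apply/idP/andP=> [jX|[]//]; split=> //; apply: (subsetP sXW).
apply/existsP=> -[c /andP[/existsP[j jW] /forallP hc]].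
have [||i hi] := h [set j in W | c j].
- by apply/subsetP=> k; rewrite inE => /andP[].
- by apply/set0Pn; exists j; rewrite inE.
by have := hc i; rewrite sumE natr_superbool hi.
Qed.

Lemma chain1 X : X \in Fl e -> chain (Fl e) [set X].
Proof.
move=> XF; rewrite /chain sub1set XF; apply/forallP=> Y; apply/implyP=> /set1P->.
by apply/forallP=> Z; apply/implyP=> /set1P->; rewrite subxx.
Qed.

Lemma chainP C :
  reflect ({subset C <= Fl e} /\
           {in C &, forall X Y, (X \subset Y) || (Y \subset X)})
          (chain (Fl e) C).
Proof.
apply: (iffP andP) => -[h1 h2]; split; try exact/subsetP.
  by move=> X Y XC YC; move/forall_inP: h2 => /(_ X XC)/forall_inP/(_ Y YC).
by apply/forall_inP=> X XC; apply/forall_inP=> Y; apply: h2.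
Qed.

Lemma chainU1 C X : chain (Fl e) C -> X \in Fl e ->
  {in C, forall Y, (X \subset Y) || (Y \subset X)} -> chain (Fl e) (X |: C).
Proof.
move=> /chainP[sC tC] XF hX; apply/chainP; split.
  by move=> Y /setU1P[->//|/sC].
move=> Y Z /setU1P[->|YC] /setU1P[->|ZC]; rewrite ?subxx ?hX //; last exact: tC.
by rewrite orbC hX.
Qed.

Lemma chain_min C : chain (Fl e) C -> C != set0 ->
  exists2 X, X \in C & forall Y, Y \in C -> X \subset Y.
Proof.
move=> /chainP[_ tC] /set0Pn[X0 X0C].
case: (arg_minnP (fun X : {set V} => #|X|) X0C) => X XC minX.
exists X => // Y YC; have /orP[//|sYX] := tC X Y XC YC.
by have /eqP-> : Y == X by rewrite eqEcard sYX minX.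
Qed.

(** A row [i] isolating a single [j] in [W] lies in the flat of [W :\ j] but not in that of [W]. The
    lower bound in the conclusion lets the induction place [starI e W] under the chain. *)
Lemma independent_chain W : ~~ dependent_columns (compl_adj e) W ->
  exists C, [/\ chain (Fl e) C, #|C| = #|W|.+1 & forall X, X \in C -> starI e W \subset X].
Proof.
elim: {W}#|W| {-2}W (erefl #|W|) => [|n IHn] W cW indW.
  exists [set starI e W]; rewrite chain1 ?starI_Fl // cards1 cW; split=> //.
  by move=> X /set1P->.
have /independentP/(_ W (subxx _)) := indW.
rewrite -card_gt0 cW => -[]// i /eqP/cards1P[j /setP hij].
have:= hij j; rewrite in_set1 eqxx inE in_star => /andP[eij jW].
have [||C [chC cC minC]] := IHn (W :\ j).
- by move: cW; rewrite (cardsD1 j W) jW => -[].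
- apply/independentP=> X sX; apply: (independentP _ indW).
  exact: subset_trans sX (subD1set _ _).
have iX X : X \in C -> i \in X.
  move=> /minC/subsetP; apply; apply/starIP=> w /setD1P[wj wW].
  by have := hij w; rewrite !inE wW andbT (negbTE wj) e_sym => /negbFE.
have nW : starI e W \notin C.
  by apply/negP=> /iX/starIP/(_ j jW); rewrite e_sym (negbTE eij).
exists (starI e W |: C); split.
- apply: chainU1; rewrite ?starI_Fl // => X /minC sX.
  by rewrite (subset_trans (starIS (subD1set _ _)) sX).
- by rewrite cardsU1 nW cC -cW [in RHS](cardsD1 j W) jW.
move=> X /setU1P[->//|/minC]; exact: subset_trans (starIS (subD1set _ _)).
Qed.

(** The induction strips off the least member [starI e U]. A point [x] in the member [Y] but not in
    [starI e U] is adjacent to all of [W] and not to some [w] of [U]; row [x] then isolates the new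
    column [w]. The member below all stars carries this adjacency through the induction. *)
Lemma chain_independent C k : chain (Fl e) C -> #|C| = k.+1 ->
  exists W, [/\ ~~ dependent_columns (compl_adj e) W, #|W| = k
    & exists2 X, X \in C & forall w, w \in W -> X \subset star e w].
Proof.
elim: k C => [|k IHk] C chC cC.
  exists set0; rewrite cards0; split=> //.
    by apply/independentP=> X; rewrite subset0 => ->.
  have /set0Pn[X XC] : C != set0 by rewrite -card_gt0 cC.
  by exists X => // w; rewrite inE.
have [|X XC minX] := chain_min chC; first by rewrite -card_gt0 cC.
have [sC tC] := chainP _ chC.
have [||W [indW cW [Y YC hY]]] := IHk (C :\ X).
- apply/chainP; split=> [Z /setD1P[_ /sC]//|Z Z' /setD1P[_ ZC] /setD1P[_]];
    exact: tC.
- by move: cC; rewrite (cardsD1 X) XC => -[].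
have /setD1P[nYX YC'] := YC; have sXY := minX _ YC'.
have /subsetPn[x xY xX] : ~~ (Y \subset X).
  by apply: contra nYX; rewrite eqEsubset sXY andbT.
have /imsetP[U _ eXU] := sC _ XC; rewrite {}eXU in XC minX sXY xX nYX.
have [w wU nxw] : exists2 w, w \in U & ~~ e w x.
  apply/exists_inP; apply: contraNT xX => /exists_inPn h.
  by apply/starIP=> w /h/negbNE.
have sYW : forall z, z \in W -> e z x.
  by move=> z /hY/subsetP/(_ x xY); rewrite in_star.
have wW : w \notin W by apply: contra nxw => /sYW.
exists (w |: W); split; last first.
- exists (starI e U) => // z /setU1P[->|/hY]; first exact: starI_sub.
  exact: subset_trans.
- by rewrite cardsU1 wW cW.
apply/independentP=> Z sZ nZ; have [wZ|wZ] := boolP (w \in Z); last first.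
  apply: (independentP _ indW) => //; apply/subsetP=> z zZ.
  by have /setU1P[zw|//] := subsetP sZ z zZ; rewrite -zw zZ in wZ.
exists x; apply/eqP/cards1P; exists w; apply/setP=> z; rewrite !inE.
have [->|nzw] := eqVneq z w; first by rewrite e_sym nxw.
apply/negbTE/andP=> -[nxz zZ]; case/negP: nxz; rewrite e_sym sYW //.
by have /setU1P[zw|//] := subsetP sZ z zZ; rewrite zw eqxx in nzw.
Qed.

Lemma c_rk_chainP k :
  reflect (exists2 C, chain (Fl e) C & k < #|C|) (k <= c_rk e).
Proof.
apply: (iffP idP) => [le_k | [C chC lt_k]].
  apply/exists_inP; apply: contraTT le_k => /exists_inPn no.
  (* The one-member chain on [setT] excludes 0, so [k] has a true predecessor. *)
  rewrite -ltnNge; have k_gt0 : 0 < k.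
    by have := no [set setT] (chain1 setT_Fl); rewrite cards1 -leqNgt.
  rewrite -(prednK k_gt0) ltnS;
    apply/bigmax_leqP=> W /independent_chain[C [chC cC _]].
  by rewrite -ltnS prednK // -cC leqNgt; apply: no.
have [|W [indW cW _]] := @chain_independent C #|C|.-1 chC;
  first by rewrite prednK // (leq_trans _ lt_k).
apply: leq_trans (leq_bigmax_cond (F := fun W : {set V} => #|W|) _ indW).
by rewrite cW -ltnS (ltn_predK lt_k).
Qed.

End Rank.

(** * The Jordan-Dedekind condition *)

Section CubicFlats.

Variables (V : finType) (e : rel V).
Hypothesis e_sym : symmetric e.
Hypothesis e_irr : irreflexive e.
Hypothesis e_cubic : cubic e.

Implicit Types (C D : {set {set V}}) (W X Y : {set V}).

Lemma star_sub_eq u v : star e u \subset star e v -> star e u = star e v.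
Proof. by move=> s; apply/eqP; rewrite eqEcard s !e_cubic. Qed.

Lemma star_proper v : star e v \proper setT.
Proof. by rewrite properT; apply/eqP/setP=> /(_ v); rewrite in_star e_irr inE. Qed.

Lemma set0_Fl : set0 \in Fl e.
Proof.
suff <- : starI e setT = set0 by apply: starI_Fl.
apply/setP=> x; rewrite inE; apply/negbTE/starIP=> /(_ x (in_setT x)).
by rewrite e_irr.
Qed.

Lemma Fl_setT_or_star X :
  X \in Fl e -> X = setT \/ exists v, X \subset star e v.
Proof.
case/imsetP=> W _ ->; have [->|[w wW]] := set_0Vmem W.
  by left; rewrite /starI big_set0.
by right; exists w; apply: starI_sub.
Qed.

Lemma Fl_card_gt3 X : X \in Fl e -> 3 < #|X| -> X = setT.
Proof.
case/Fl_setT_or_star=> // -[v /subset_leq_card].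
by rewrite e_cubic ltnNge => ->.
Qed.

(** Comparable sets of equal size coincide, and the cap at 4 loses nothing because only [setT] can
    have more than three elements. *)
Lemma chain_card_inj C X Y : chain (Fl e) C -> X \in C -> Y \in C ->
  minn #|X| 4 = minn #|Y| 4 -> X = Y.
Proof.
move=> /chainP[sC tC] XC YC; have [lt_X|ge_X] := ltnP #|X| 4; last first.
  have [|ge_Y _] := ltnP #|Y| 4; first by move=> lt_Y cXY; rewrite -cXY ltnn in lt_Y.
  by rewrite (Fl_card_gt3 (sC _ XC) ge_X) (Fl_card_gt3 (sC _ YC) ge_Y).
have [_ cXY|ge_Y cXY] := ltnP #|Y| 4; last by rewrite cXY in lt_X.
by have /orP[s|s] := tC X Y XC YC; [|symmetry]; apply/eqP;
  rewrite eqEcard s cXY leqnn.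
Qed.

Let capped_card X : 'I_5 := inord (minn #|X| 4).

Lemma chain_card_imset C : chain (Fl e) C ->
  #|[set capped_card X | X in C]| = #|C|.
Proof.
move=> chC; apply: card_in_imset => X Y XC YC /(congr1 val).
by rewrite /= !inordK ?ltnS ?geq_minr //; apply: (chain_card_inj chC).
Qed.

Lemma chain_card_le5 C : chain (Fl e) C -> #|C| <= 5.
Proof. by move=> chC; rewrite -(chain_card_imset chC) (leq_trans (max_card _)) ?card_ord. Qed.

Lemma chain5_card C k : chain (Fl e) C -> #|C| = 5 -> k <= 3 ->
  exists2 X, X \in C & #|X| = k.
Proof.
move=> chC cC le_k; have /setP/(_ (inord k)) :
    [set capped_card X | X in C] = setT.
  by apply/eqP; rewrite eqEcard subsetT cardsT card_ord chain_card_imset ?cC.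
rewrite inE => /imsetP[X XC /(congr1 val)]; rewrite /= !inordK ?ltnS ?geq_minr //;
  last exact: leq_trans le_k _.
by move=> kE; exists X => //; rewrite kE; apply/esym/minn_idPl; rewrite leqNgt;
  apply: contraL le_k => gt; rewrite kE (minn_idPr (ltnW gt)).
Qed.

Lemma maximal_chain_exists C : chain (Fl e) C ->
  exists2 D, maximal_chain (Fl e) D & C \subset D.
Proof. by case/maxset_exists=> D; exists D. Qed.

Lemma maximal_chain_mem C X : maximal_chain (Fl e) C -> X \in Fl e ->
  {in C, forall Y, (X \subset Y) || (Y \subset X)} -> X \in C.
Proof.
move=> /maxsetP[chC maxC] XF hX; rewrite -(maxC (X |: C)) ?setU11 ?subsetUr //.
exact: chainU1.
Qed.

Lemma maximal_chain_set0 C : maximal_chain (Fl e) C -> set0 \in C.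
Proof.
move=> mC; apply: (maximal_chain_mem mC set0_Fl) => Y _.
by rewrite sub0set.
Qed.

Lemma maximal_chain_setT C : maximal_chain (Fl e) C -> setT \in C.
Proof.
move=> mC; apply: (maximal_chain_mem mC); first exact: setT_Fl.
by move=> Y _; rewrite subsetT orbT.
Qed.

(** The largest member other than [setT] lies in a star. That star is comparable with the whole
    chain, so maximality puts it in. The vertex [v] makes [set0] differ from [setT]. *)
Lemma maximal_chain_star C (v : V) : maximal_chain (Fl e) C ->
  exists w, star e w \in C.
Proof.
move=> mC; have [chC maxC] := maxsetP mC; have [sC tC] := chainP _ _ chC.
have h0 : set0 \in C :\ setT.
  by rewrite !inE (maximal_chain_set0 mC) andbT eq_sym; apply/set0Pn; exists v.
case: (arg_maxnP (fun X : {set V} => #|X|) h0) => X /setD1P[XT XC] maxX.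
have [/eqP|[w sXw]] := Fl_setT_or_star (sC _ XC); first by rewrite (negbTE XT).
exists w; apply: (maximal_chain_mem mC (star_Fl e w)) => Y YC.
have [->|YT] := eqVneq Y setT; first by rewrite subsetT.
have cY : #|Y| <= #|X| by apply: maxX; apply/setD1P.
have /orP[sXY|sYX] := tC X Y XC YC.
  by have /eqP<- : X == Y; rewrite ?eqEcard ?sXY // sXw orbT.
by rewrite (subset_trans sYX sXw) orbT.
Qed.

(** * Consequences of the Jordan-Dedekind condition for c-rank above 3 *)

(** Some maximal chain has five members, hence all have, and five members realize every size up to
    3. This is applied to a maximal chain containing [C]. *)
Lemma jordan_dedekind_card C k : jordan_dedekind (Fl e) -> 3 < c_rk e ->
    chain (Fl e) C -> k <= 3 ->
  exists X, [/\ X \in Fl e, #|X| = k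
    & {in C, forall Y, (X \subset Y) || (Y \subset X)}].
Proof.
move=> jd /(c_rk_chainP e_sym)[B chB cB] chC le_k.
have [B' mB sBB'] := maximal_chain_exists chB.
have [D mD sCD] := maximal_chain_exists chC.
have [chB' _] := maxsetP mB; have [chD _] := maxsetP mD.
have cB' : #|B'| = 5.
  apply/eqP; rewrite eqn_leq chain_card_le5 //=.
  exact: leq_trans cB (subset_leq_card sBB').
have cD : #|D| = 5.
  have := jd _ _ mB mD; rewrite /chain_length cB'; case: #|D| => //= n.
  by move=> <-.
have [X XD cX] := chain5_card chD cD le_k.
have [sD tD] := chainP _ _ chD.
exists X; split; rewrite ?sD // => Y /(subsetP sCD); exact: tD.
Qed.

(** The flat is an intersection of stars; were they all equal to [star e v], so would be the
    intersection. *)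
Lemma Fl_sub_other_star X v : X \in Fl e -> X \subset star e v -> X != star e v ->
  exists2 w, X \subset star e w & star e w != star e v.
Proof.
case/imsetP=> W _ -> sWv; have [W0|[w wW]] := set_0Vmem W.
  by rewrite W0 /starI big_set0 subTset in sWv *;
    move/eqP: sWv (proper_card (star_proper v)) => ->; rewrite ltnn.
move=> nW; apply/exists_inP; apply: contraNT nW => /exists_inPn h.
rewrite eqEsubset sWv; apply/subsetP=> x; rewrite in_star => vx.
apply/starIP=> z zW; have := h z (starI_sub _ zW).
by move/negbNE/eqP/setP/(_ x); rewrite !in_star vx.
Qed.

(** Suppose [u] and [v] are distinct with the same star. A two-element flat [X] inside it lies in a
    further star, that of [w], so every element of [X] has the neighbours [u], [v], [w]. A singleton
    flat inside [X] would separate two vertices with equal stars, which no intersection of stars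
    does. *)
Lemma jordan_dedekind_sober :
  jordan_dedekind (Fl e) -> 3 < c_rk e -> sober e.
Proof.
move=> jd rk u v Suv; apply/eqP; apply: contraT => nuv.
have [X [XF cX /(_ _ (set11 _)) hX]] :=
  jordan_dedekind_card jd rk (chain1 (star_Fl e v)) (isT : 2 <= 3).
have sXv : X \subset star e v.
  case/orP: hX => // /subset_leq_card; by rewrite e_cubic cX.
have nXv : X != star e v.
  by apply: contra_eqN cX => /eqP->; rewrite e_cubic.
have [w sXw nwv] := Fl_sub_other_star XF sXv nXv.
have starX x : x \in X -> star e x = [set u; v; w].
  move=> xX; have xu : x \in star e u by rewrite Suv (subsetP sXv).
  have xv := subsetP sXv x xX; have xw := subsetP sXw x xX.
  apply/esym/eqP; rewrite eqEcard e_cubic; apply/andP; split.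
    by apply/subsetP=> z; rewrite !inE => /orP[/orP[]|] /eqP->;
      rewrite e_sym -in_star.
  apply/card_gt2P; exists u, v, w; split; split; rewrite ?inE ?eqxx ?orbT //.
  - by apply: contraNneq nwv => ->.
  - by apply: contraNneq nwv => ->; rewrite Suv.
have [Y [YF cY /(_ _ (set11 _)) hY]] := jordan_dedekind_card jd rk (chain1 XF) (isT : 1 <= 3).
have sYX : Y \subset X by case/orP: hY => // /subset_leq_card; rewrite cY cX.
have /subsetPn[b bX bY] : ~~ (X \subset Y).
  by apply/negP=> /subset_leq_card; rewrite cY cX.
move/eqP/cards1P: cY => [a eY];
  have aX : a \in X by rewrite (subsetP sYX) // eY set11.
case/imsetP: YF => W _ eYW; case/negP: bY; rewrite eYW; apply/starIP=> z zW.
have /starIP/(_ z zW) : a \in starI e W by rewrite -eYW eY set11.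
by rewrite e_sym -in_star starX // -(starX b bX) in_star e_sym.
Qed.

(** A vertex adjacent to all neighbours of [a] has the star of [a], hence is [a]. *)
Lemma sober_set1_Fl a : sober e -> [set a] \in Fl e.
Proof.
move=> sob; have <- : starI e (star e a) = [set a]; last exact: starI_Fl.
apply/setP=> x; rewrite inE; apply/starIP/eqP=> [h|-> w];
  last by rewrite in_star e_sym.
apply/esym/sob/star_sub_eq/subsetP=> y /h; by rewrite in_star e_sym.
Qed.

(** A flat with elements [a] and [b], inserted between [[set a]] and [star e v], lies in another
    star, that of [w]; then [v], [a], [w], [b] form a square. *)
Lemma jordan_dedekind_squares :
  jordan_dedekind (Fl e) -> 3 < c_rk e -> every_edge_in_square e.
Proof.
move=> jd rk v a va; have sob := jordan_dedekind_sober jd rk.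
have ch : chain (Fl e) (star e v |: [set [set a]]).
  apply: chainU1; rewrite ?star_Fl ?chain1 ?sober_set1_Fl // => _ /set1P->.
  by rewrite orbC sub1set in_star va.
have [X [XF cX hX]] := jordan_dedekind_card jd rk ch (isT : 2 <= 3).
have sXv : X \subset star e v.
  by case/orP: (hX _ (setU11 _ _)) => // /subset_leq_card; rewrite e_cubic cX.
have aX : a \in X.
  have /orP[/subset_leq_card|] := hX _ (setU1r _ (set11 _)); last by rewrite sub1set.
  by rewrite cX cards1.
have nXv : X != star e v by apply: contra_eqN cX => /eqP->; rewrite e_cubic.
have [w sXw nwv] := Fl_sub_other_star XF sXv nXv.
have /subsetPn[b bX ba] : ~~ (X \subset [set a]).
  by apply/negP=> /subset_leq_card; rewrite cX cards1.
have := (subsetP sXv b bX, subsetP sXw b bX, subsetP sXw a aX).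
rewrite !in_star in_set1 in ba * => -[[vb wb] wa]; exists w, b.
have neq x y : e x y -> x != y by move=> exy; apply: contraTneq exy => ->;
  rewrite e_irr.
have aw : e a w by rewrite e_sym.
have nvw : v != w by apply: contraNneq nwv => ->.
by rewrite /ucycle /= va aw wb e_sym vb !inE !negb_or nvw (eq_sym a b) ba !neq.
Qed.

Lemma jordan_dedekind_c_rk_or_squares :
  jordan_dedekind (Fl e) -> c_rk e <= 3 \/ sober e /\ every_edge_in_square e.
Proof.
move=> jd; case: leqP => [|rk]; [by left | right].
by split; [apply: jordan_dedekind_sober | apply: jordan_dedekind_squares].
Qed.

(** * Maximal chains in sober graphs whose edges lie in squares *)

Lemma maximal_chain_squares C (v : V) : sober e -> every_edge_in_square e ->
  maximal_chain (Fl e) C -> #|C| = 5.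
Proof.
move=> sob sq mC; have [chC _] := maxsetP mC; have [sC tC] := chainP _ _ chC.
have [w wC] := maximal_chain_star v mC.
have h0 : star e w \in C :\ set0.
  by rewrite in_setD1 wC andbT -card_gt0 e_cubic.
(* The least nonempty member [X]: the singleton of any of its points is comparable with the whole
   chain. *)
case: (arg_minnP (fun X : {set V} => #|X|) h0) => X /setD1P[X0 XC] minX.
have {}minX Y : Y \in C -> Y != set0 -> X \subset Y.
  move=> YC Y0; have /orP[//|s] := tC X Y XC YC.
  by have /eqP-> : Y == X; rewrite // eqEcard s; apply: minX; apply/setD1P.
have /set0Pn[a aX] := X0.
have aC : [set a] \in C.
  apply: (maximal_chain_mem mC (sober_set1_Fl a sob)) => Y YC.
  have [->|Y0] := eqVneq Y set0; first by rewrite sub0set orbT.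
  by rewrite sub1set (subsetP (minX Y YC Y0)).
have wa : e w a by rewrite -in_star (subsetP (minX _ wC _)) // -card_gt0 e_cubic.
apply/eqP; rewrite eqn_leq chain_card_le5 //=.
have gt_V : 3 < #|[set: V]| by rewrite -(e_cubic w) proper_card ?star_proper.
(* If no member has two elements, the common neighbours [a] and [t] of [w] and [z] in a square form
   a flat that fits between [[set a]] and [star e w]. A third common neighbour would contradict
   soberness. *)
have [Z ZC cZ] : exists2 Z, Z \in C & #|Z| == 2.
  apply/exists_inP; apply: contraT => /exists_inPn no2.
  have [z [t /andP[/and5P[_ az zt tw _]]]] := sq w a wa; rewrite /= !inE !negb_or.
  case/and4P=> /and3P[nwa nwz nwt] /andP[naz nat] nzt _.
  have Zz : starI e [set w; z] \subset star e z by rewrite starI_sub // set22.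
  have Zw : starI e [set w; z] \subset star e w by rewrite starI_sub // set21.
  have aZ : a \in starI e [set w; z].
    by apply/starIP=> y; rewrite !inE => /orP[] /eqP-> //; rewrite e_sym.
  have tZ : t \in starI e [set w; z].
    by apply/starIP=> y; rewrite !inE => /orP[] /eqP-> //; rewrite e_sym.
  have c2 : #|starI e [set w; z]| == 2.
    rewrite eqn_leq; apply/andP; split; last by apply/card_gt1P; exists a, t.
    rewrite -ltnS -(e_cubic w) proper_card // properEneq Zw andbT.
    apply: contraNneq nwz => Zeq; rewrite Zeq in Zz.
    exact/eqP/sob/star_sub_eq.
  suff /no2 : starI e [set w; z] \in C by rewrite c2.
  apply: (maximal_chain_mem mC) => [|Y YC]; first exact: starI_Fl.
  have [->|Y0] := eqVneq Y set0; first by rewrite sub0set orbT.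
  have /orP[s|s] := tC Y _ YC wC; last by rewrite (subset_trans Zw).
  have [->|Yw] := eqVneq Y (star e w); first by rewrite Zw.
  have aY : a \in Y by apply: subsetP aX; apply: minX.
  (* Here [Y] contains [a], is strictly inside [star e w] and does not have two elements. *)
  have /eqP <- : [set a] == Y; last by rewrite sub1set aZ orbT.
  rewrite eqEcard sub1set aY cards1 -ltnS ltn_neqAle no2 // -ltnS -(e_cubic w).
  by rewrite proper_card // properEneq Yw.
apply/card_geqP; exists [:: set0; [set a]; Z; star e w; setT]; split=> //.
  apply: (@map_uniq _ _ (fun X : {set V} => #|X|)).
  rewrite /= cards0 cards1 (eqP cZ) e_cubic !inE /=.
  by move: gt_V; case: #|_| => [|[|[|[|]]]].
apply/allP; rewrite /= (maximal_chain_set0 mC) aC ZC wC.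
by rewrite (maximal_chain_setT mC).
Qed.

Lemma squares_jordan_dedekind (v : V) :
  sober e -> every_edge_in_square e -> jordan_dedekind (Fl e).
Proof.
move=> sob sq C D mC mD; rewrite /chain_length.
by rewrite !(maximal_chain_squares v sob sq).
Qed.

(** * Maximal chains with three members and c-rank at most 3 *)

Lemma maximal_chain_card_ge3 C (v : V) : maximal_chain (Fl e) C -> 3 <= #|C|.
Proof.
move=> mC; have [w wC] := maximal_chain_star v mC.
apply/card_gt2P; exists set0, (star e w), setT.
rewrite maximal_chain_set0 // maximal_chain_setT // wC; split; split=> //.
- by rewrite eq_sym -card_gt0 e_cubic.
- by have := star_proper w; rewrite properT.
by apply/set0Pn; exists v.
Qed.

(** The chain consists of [set0], one star and [setT]. The intersection of that star with another
    one is comparable with all three, so it is a member. *)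
Lemma maximal_chain3_star_minimal C (v : V) : maximal_chain (Fl e) C -> #|C| = 3 ->
  exists w, forall u, star e u :&: star e w != set0 -> star e u = star e w.
Proof.
move=> mC cC; have [w wC] := maximal_chain_star v mC; exists w => u nuw.
have h0 : star e w != set0 by rewrite -card_gt0 e_cubic.
have hT : star e w != setT by have := star_proper w; rewrite properT.
have nT : setT != set0 :> {set V} by apply/set0Pn; exists v.
have CE : C = [set set0; star e w; setT].
  apply/esym/eqP; rewrite eqEcard; apply/andP; split.
    apply/subsetP=> X; rewrite !inE => /orP[/orP[]|] /eqP-> //.
      exact: maximal_chain_set0.
    exact: maximal_chain_setT.
  rewrite cC; apply/card_gt2P; exists set0, (star e w), setT.
  by rewrite !inE !eqxx !orbT eq_sym h0 hT nT.
have : starI e [set u; w] \in C.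
  apply: (maximal_chain_mem mC) => [|Y]; first exact: starI_Fl.
  rewrite CE !inE => /orP[/orP[]|] /eqP->.
  - by rewrite sub0set orbT.
  - by rewrite starI_sub // set22.
  - by rewrite subsetT.
have -> : starI e [set u; w] = star e u :&: star e w.
  apply/setP=> x; rewrite inE !in_star; apply/starIP/andP=> [h|[ux wx] y].
    by rewrite !h ?set21 ?set22.
  by rewrite !inE => /orP[] /eqP->.
rewrite CE !inE (negbTE nuw) /= => /orP[] /eqP eI.
  by apply/esym/star_sub_eq; rewrite -eI subsetIl.
by case/negP: hT; rewrite -subTset -eI subsetIr.
Qed.

Hypothesis e_conn : connected e.

Lemma equal_or_disjoint_stars w :
    (forall u, star e u :&: star e w != set0 -> star e u = star e w) ->
  forall v u, star e u :&: star e v != set0 -> star e u = star e v.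
Proof.
pose Q v := [forall u, (star e u :&: star e v != set0) ==> (star e u == star e v)].
have QP v : reflect (forall u, star e u :&: star e v != set0 -> star e u = star e v) (Q v).
  by apply: (iffP forall_inP) => h u /h /eqP.
move=> /QP Qw v; apply/QP; suff cl : closed e Q.
  by have <- : (w \in Q) = Q v := closed_connect cl (e_conn w v).
apply: intro_closed; first exact: sym_connect_sym.
move=> {w Qw}v w vw /QP Qv; apply/QP=> u /set0Pn[x];
  rewrite inE !in_star => /andP[ux wx].
(* The stars of [x] and [v] share [w]; below, those of [y] and [v] share [u]. *)
have Sx : star e x = star e v.
  by apply: Qv; apply/set0Pn; exists w; rewrite inE !in_star e_sym wx.
have uv : e v u by rewrite -in_star -Sx in_star e_sym.
apply: star_sub_eq; apply/subsetP=> y; rewrite !in_star => uy.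
suff Sy : star e y = star e v by rewrite e_sym -in_star Sy in_star.
by apply: Qv; apply/set0Pn; exists u; rewrite inE !in_star e_sym uy.
Qed.

(** Every flat is then [set0], [setT] or a star, and comparable stars coincide. *)
Lemma equal_or_disjoint_chain C :
    (forall v u, star e u :&: star e v != set0 -> star e u = star e v) ->
  chain (Fl e) C -> #|C| <= 3.
Proof.
move=> eqd /chainP[sC tC].
have FlE X : X \in Fl e -> X != set0 -> X != setT -> exists w, X = star e w.
  case/imsetP=> W _ -> X0; have [->|[w wW]] := set_0Vmem W.
    by rewrite /starI big_set0 eqxx.
  exists w; apply/eqP; rewrite eqEsubset starI_sub //; apply/subsetP=> x.
  have /set0Pn[y yW] := X0; rewrite in_star => wx; apply/starIP=> z zW.
  rewrite -in_star (eqd w z) ?in_star //; apply/set0Pn; exists y.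
  by rewrite inE (subsetP (starI_sub e wW) y yW) (subsetP (starI_sub e zW) y yW).
have [/forall_inP h|] := boolP [forall X in C, (X == set0) || (X == setT)].
  have /subset_leq_card : C \subset [set set0; setT].
    by apply/subsetP=> X /h; rewrite !inE.
  by move/leq_trans; apply; rewrite cards2; case: eqP.
case/forall_inPn=> X XC; rewrite negb_or => /andP[X0 XT].
have [w Xw] := FlE X (sC _ XC) X0 XT; rewrite {}Xw in XC X0 XT.
have /subset_leq_card : C \subset [set set0; star e w; setT].
  apply/subsetP=> Y YC; rewrite !inE; have [//|Y0] := eqVneq Y set0.
  have [|YT] := eqVneq Y setT; first by rewrite orbT.
  have [u Yu] := FlE Y (sC _ YC) Y0 YT; rewrite {}Yu in YC Y0 YT *.
  by have /orP[/star_sub_eq->|/star_sub_eq->] := tC _ _ XC YC; rewrite eqxx.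
move/leq_trans; apply; rewrite (leq_trans (leq_card_setU _ _)) // cards1 cards2.
by case: eqP.
Qed.

(** As soon as there is a vertex, maximal chains have three or four members, and a single one with
    three forces three throughout. *)
Lemma c_rk_le3_jordan_dedekind : c_rk e <= 3 -> jordan_dedekind (Fl e).
Proof.
move=> rk C D mC mD; rewrite /chain_length.
have [V0|[v _]] := set_0Vmem [set: V].
  have all0 X : X = set0 by apply/eqP; rewrite -subset0 -V0 subsetT.
  suff F0 B : maximal_chain (Fl e) B -> B = [set set0] by rewrite (F0 C mC) (F0 D mD).
  move=> mB; apply/setP=> X; rewrite (all0 X) in_set1 eqxx.
  exact: maximal_chain_set0 mB.
have le4 B : maximal_chain (Fl e) B -> #|B| <= 4.
  case/maxsetP=> chB _; rewrite leqNgt; apply: contraL rk => gtB.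
  by rewrite -ltnNge; apply/(c_rk_chainP e_sym); exists B.
have eq3 B B' : maximal_chain (Fl e) B -> maximal_chain (Fl e) B' -> #|B| = 3 -> #|B'| = 3.
  move=> mB mB' /(maximal_chain3_star_minimal v mB)[w /equal_or_disjoint_stars eqd].
  apply/eqP; rewrite eqn_leq (maximal_chain_card_ge3 v) // andbT.
  by apply: equal_or_disjoint_chain => //; case/maxsetP: mB'.
have := maximal_chain_card_ge3 v mC; rewrite leq_eqVlt => /orP[/eqP c3|c4].
  by rewrite -c3 (eq3 C D).
have := maximal_chain_card_ge3 v mD; rewrite leq_eqVlt => /orP[/eqP c3|d4].
  by rewrite -c3 (eq3 D C).
by congr _.-1; apply/eqP; rewrite eqn_leq (leq_trans (le4 C mC)) // (leq_trans (le4 D mD)).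
Qed.

End CubicFlats.

(** * Ladders *)

Section LadderGraphs.

Variables (m : nat) (t : bool).
Hypothesis m_ge2 : 2 <= m.
Local Notation n := m.+1.

Implicit Types p q : bool * 'I_n.

Definition rung_partner p : bool * 'I_n := (~~ p.1, p.2).

(** One step forward along the rails, closing edges included; under the twist the step from the last
    rung changes rail. *)
Definition ladder_next p : bool * 'I_n :=
  if p.2 == m :> nat then (p.1 (+) t, ord0) else (p.1, inord p.2.+1).

Lemma ladderE p q : ladder t p q =
  [|| q == rung_partner p, q == ladder_next p | p == ladder_next q].
Proof.
(* On the last rung only [closing] applies, elsewhere only [rail]. *)
have stepE p' q' : rail p' q' || closing t p' q' = (q' == ladder_next p').
  case: p' q' => b i [c j]; rewrite /rail /closing /ladder_next /= eqSS [b == c]eq_sym.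
  have [im|im] := eqVneq (i : nat) m.
    by rewrite xpair_eqE im (ltn_eqF (ltn_ord j)) andbF.
  rewrite andbF orbF xpair_eqE -[j == _]val_eqE /= inordK //.
  by rewrite ltnS ltn_neqAle im -ltnS ltn_ord.
have rungE : rung p q || rung q p = (q == rung_partner p).
  case: p q => b i [c j]; rewrite /rung /rung_partner /= xpair_eqE.
  by rewrite [j == i]eq_sym; case: b; case: c; rewrite /= ?orbF.
rewrite /ladder /sym_closure /= -rungE -!stepE.
by case: (rail p q); case: (rung p q); case: (closing t p q); case: (rail q p);
  case: (rung q p); case: (closing t q p).
Qed.

Lemma ladder_next_index p : (ladder_next p).2 = p.2.+1 %% n :> nat.
Proof.
rewrite /ladder_next; case: eqP => [->|/eqP pm] /=; first by rewrite modnn.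
have lt_p : p.2.+1 < n by rewrite ltnS ltn_neqAle pm -ltnS ltn_ord.
by rewrite inordK // modn_small.
Qed.

Lemma ladder_next_inj : injective ladder_next.
Proof.
move=> p q eq_pq.
have := congr1 (fun r => nat_of_ord r.2) eq_pq; rewrite !ladder_next_index => ei.
have {ei} ei : p.2 = q.2.
  apply/val_inj; move/eqP: ei; rewrite -(addn1 p.2) -(addn1 q.2) eqn_modDr !modn_small ?ltn_ord //.
  by move/eqP.
have := congr1 fst eq_pq; rewrite /ladder_next ei;
  case: p q ei {eq_pq} => b i [c j] /= ->.
by case: eqP => _ /=; [move/addIb->|move->].
Qed.

Lemma rung_partnerK : involutive rung_partner.
Proof. by case=> b i; rewrite /rung_partner /= negbK. Qed.

Lemma rung_partner_next p :
  rung_partner (ladder_next p) = ladder_next (rung_partner p).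
Proof. by rewrite /rung_partner /ladder_next /=; case: eqP; rewrite /= ?addNb. Qed.

Lemma iter_ladder_next_index k p :
  (iter k ladder_next p).2 = (p.2 + k) %% n :> nat.
Proof.
elim: k => [|k IHk]; first by rewrite addn0 modn_small ?ltn_ord.
by rewrite iterS ladder_next_index IHk -(addn1 (_ %% _)) modnDml addn1 addnS.
Qed.

Lemma iter_ladder_next_neq k p q :
  p.2 = q.2 -> ~~ (n %| k) -> iter k ladder_next p != q.
Proof.
move=> pq; apply: contra => /eqP/(congr1 (fun r => nat_of_ord r.2)).
rewrite iter_ladder_next_index pq -{2}[nat_of_ord q.2](@modn_small _ n) ?ltn_ord //.
by rewrite -[X in _ = X %[mod n]]addn0 => /eqP; rewrite eqn_modDl mod0n.
Qed.

Lemma ladder_next_neq p q : p.2 = q.2 -> ladder_next p != q.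
Proof.
by move=> pq; rewrite (iter_ladder_next_neq (k := 1)) // gtnNdvd // ltnS ltnW.
Qed.

Lemma ladder_next2_neq p q : p.2 = q.2 -> ladder_next (ladder_next p) != q.
Proof. by move=> pq; rewrite (iter_ladder_next_neq (k := 2)) // gtnNdvd. Qed.

Lemma rung_partner_neq p : rung_partner p != p.
Proof. by case: p => b i; rewrite /rung_partner xpair_eqE; case: b. Qed.

(** The neighbours are the rung partner, the successor and the predecessor. They lie on different
    rungs, as there are at least three. *)
Lemma ladder_cubic : cubic (ladder t : rel (bool * 'I_n)).
Proof.
move=> p; have [prev _ prevK] := injF_bij ladder_next_inj.
have -> : star (ladder t) p = [set rung_partner p; ladder_next p; prev p].
  apply/setP=> q; rewrite in_star ladderE !inE -orbA; do 2!congr (_ || _).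
  by apply/eqP/eqP=> [->|->]; [apply: ladder_next_inj|]; rewrite prevK.
have nrn : rung_partner p != ladder_next p by rewrite eq_sym ladder_next_neq.
have nrp : rung_partner p != prev p.
  by apply/eqP=> /(congr1 ladder_next)/eqP;
    rewrite prevK (negbTE (ladder_next_neq _)).
have nnp : ladder_next p != prev p.
  by apply/eqP=> /(congr1 ladder_next)/eqP;
    rewrite prevK (negbTE (ladder_next2_neq _)).
by rewrite setUC cardsU1 cards2 nrn !inE negb_or ![prev p == _]eq_sym nrp nnp.
Qed.

Lemma ladder_squares : every_edge_in_square (ladder t : rel (bool * 'I_n)).
Proof.
have adjN p : ladder t p (ladder_next p) by rewrite ladderE eqxx orbT.
have adjNV p : ladder t (ladder_next p) p by rewrite ladderE eqxx !orbT.
have adjR p : ladder t p (rung_partner p) by rewrite ladderE eqxx.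
have adjRV p : ladder t (rung_partner p) p by rewrite ladderE rung_partnerK eqxx.
have uq p : uniq [:: p; rung_partner p; ladder_next (rung_partner p); ladder_next p].
  rewrite /= !inE !negb_or (inj_eq ladder_next_inj) rung_partner_neq.
  by rewrite [p == rung_partner p]eq_sym rung_partner_neq ![_ == ladder_next _]eq_sym
    !ladder_next_neq.
move=> p q; rewrite ladderE => /or3P[] /eqP eq_pq.
- exists (ladder_next q), (ladder_next p); rewrite /ucycle eq_pq uq /=.
  by rewrite adjR adjN adjNV -rung_partner_next adjRV.
- exists (ladder_next (rung_partner p)), (rung_partner p); rewrite eq_pq /ucycle.
  rewrite -(rot_uniq 1) -rev_uniq uq /=.
  by rewrite adjN adjNV adjRV -rung_partner_next adjR.
exists (rung_partner q), (ladder_next (rung_partner q)); rewrite eq_pq /ucycle.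
rewrite -(rot_uniq 1) uq /=.
by rewrite adjNV adjR adjN -rung_partner_next adjRV.
Qed.

Hypothesis t_ge3 : t -> 3 <= m.

(** With four or more rungs, three steps change the rung. With three rungs there is no twist, so
    they stay on the rail opposite to [p]; the twisted ladder on three rungs is the non-sober graph
    $K_{3,3}$. *)
Lemma ladder_next3_neq p : iter 3 ladder_next (rung_partner p) != p.
Proof.
have [m3|m2] := ltnP 2 m; first by rewrite iter_ladder_next_neq // gtnNdvd.
have m2E : m = 2 by apply/eqP; rewrite eqn_leq m2.
have tF : t = false by apply/negP=> /t_ge3; rewrite m2E.
have fstE q : (ladder_next q).1 = q.1.
  by rewrite /ladder_next tF; case: eqP; rewrite /= ?addbF.
by apply/eqP=> /(congr1 fst); rewrite /= !fstE /=; case: (p.1).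
Qed.

(** Since [p] is the successor of the partner of [q], its own successor can neither be that partner
    (two steps would close up) nor the predecessor of [q] (three steps would lead from the partner
    to [q]). *)
Lemma ladder_star_next p q :
  star (ladder t) p = star (ladder t) q -> rung_partner p = ladder_next q -> p = q.
Proof.
move=> Spq rp; have pE : p = ladder_next (rung_partner q).
  by rewrite -rung_partner_next -rp rung_partnerK.
have : ladder_next p \in star (ladder t) q by rewrite -Spq in_star ladderE eqxx orbT.
rewrite in_star ladderE => /or3P[]; last 1 first.
- by rewrite pE eq_sym (negbTE (ladder_next3_neq q)).
- by rewrite {1}pE (negbTE (ladder_next2_neq _)).
by move=> /eqP/ladder_next_inj.
Qed.

Lemma ladder_sober : sober (ladder t : rel (bool * 'I_n)).
Proof.
move=> p q Spq.
have : rung_partner p \in star (ladder t) q by rewrite -Spq in_star ladderE eqxx.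
rewrite in_star ladderE => /or3P[/eqP/(inv_inj rung_partnerK)//|/eqP|/eqP qE].
  exact: ladder_star_next.
apply/esym/ladder_star_next; rewrite ?Spq // qE rung_partner_next.
by rewrite rung_partnerK.
Qed.

End LadderGraphs.

(** * The complete graph, and transport along isomorphisms *)

Lemma complete_graph4_sober : sober (complete_graph 4).
Proof.
move=> i j /setP/(_ i); rewrite !in_star /complete_graph /= eqxx.
by move/esym/negbFE/eqP.
Qed.

Lemma complete_graph4_squares : every_edge_in_square (complete_graph 4).
Proof.
move=> i j; rewrite /complete_graph /= => nij.
have : #|~: [set i; j]| = 2.
  by apply/eqP; rewrite -(eqn_add2l #|[set i; j]|) cardsC card_ord cards2 nij.
move/eqP/cards2P=> [k [l [nkl kl]]].
have := set21 k l; have := set22 k l; rewrite -kl !inE !negb_or.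
move=> /andP[nli nlj] /andP[nki nkj]; exists k, l.
by rewrite /ucycle /= !inE !negb_or nij nkl nli (eq_sym i k) (eq_sym i l) (eq_sym j k)
  (eq_sym j l) nki nkj nli nlj.
Qed.

Section GraphIso.

Variables (V U : finType) (e : rel V) (e' : rel U).

Lemma graph_iso_sym : graph_iso e e' -> graph_iso e' e.
Proof.
case=> f [g fK gK] fE; exists g; first by exists f.
by move=> x y; rewrite -fE !gK.
Qed.

Lemma graph_iso_sober : graph_iso e e' -> sober e' -> sober e.
Proof.
case=> f [g fK gK] fE sob x y Sxy; apply: (can_inj fK); apply: sob.
by apply/setP=> z; rewrite !in_star -[z]gK !fE -!in_star Sxy.
Qed.

Lemma graph_iso_squares :
  graph_iso e e' -> every_edge_in_square e' -> every_edge_in_square e.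
Proof.
case=> f [g fK gK] fE sq x y; rewrite -fE => /sq[z [t]].
rewrite -[z]gK -[t]gK => /andP[cyc]; rewrite -[[:: _; _; _; _]]/(map f [:: x;
  y; g z; g t]).
rewrite (map_inj_uniq (can_inj fK)) => uq; exists (g z), (g t).
by move: cyc; rewrite /ucycle uq andbT /= !fE.
Qed.

End GraphIso.

(** * Strips in sober cubic graphs whose edges lie in squares *)

Section Strips.

Variables (V : finType) (e : rel V).
Hypothesis e_sym : symmetric e.
Hypothesis e_irr : irreflexive e.
Hypothesis e_cubic : cubic e.

Implicit Types (f g : bool -> nat -> V) (b c : bool) (i j n : nat) (x y z : V).

Lemma cubic_neighbours v x y z w : uniq [:: x; y; z] ->
  e v x -> e v y -> e v z -> e v w -> w \in [:: x; y; z].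
Proof.
move=> uq vx vy vz vw.
have /setP/(_ w) : [set u in [:: x; y; z]] = star e v.
  apply/eqP; rewrite eqEcard e_cubic cardsE (card_uniqP _) // leqnn andbT.
  by apply/subsetP=> u; rewrite in_star !inE => /or3P[] /eqP->.
by rewrite in_star vw inE.
Qed.

Lemma cubic_no4 v x y z w : uniq [:: x; y; z; w] ->
  e v x -> e v y -> e v z -> e v w -> False.
Proof.
rewrite -(rot_uniq 3) => /= /andP[nw uq] vx vy vz vw.
by rewrite (cubic_neighbours _ vx vy vz vw) in nw.
Qed.

Lemma cubic_third v x y : exists z, [/\ e v z, z != x & z != y].
Proof.
have /subsetPn[z] : ~~ (star e v \subset [set x; y]).
  apply/negP=> /subset_leq_card; rewrite e_cubic cards2 ltnNge.
  by case: (_ != _).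
by rewrite in_star !inE negb_or => vz /andP[zx zy]; exists z.
Qed.

(** A ladder with [n] rungs inside the graph: [b] names the rail, [i] the rung. Only values with
    [i < n] matter, and further edges between its vertices are allowed. *)
Record strip n f : Prop := Strip {
  strip_rung : forall b i, i < n -> e (f b i) (f (~~ b) i);
  strip_rail : forall b i, i.+1 < n -> e (f b i) (f b i.+1);
  strip_eq : forall b c i j, i < n -> j < n ->
    (f b i == f c j) = (b == c) && (i == j) }.

Definition on_strip n f x : Prop := exists b, exists2 i, i < n & x = f b i.

Definition on_stripb n f x := [exists p : bool * 'I_n, x == f p.1 p.2].

Lemma on_stripP n f x : reflect (on_strip n f x) (on_stripb n f x).
Proof.
apply: (iffP existsP) => [[[b i] /eqP ->]|[b [i lt_i ->]]]; first by exists b, i.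
by exists (b, Ordinal lt_i).
Qed.

Lemma on_strip_vertex n f b i : i < n -> on_stripb n f (f b i).
Proof. by move=> lt_i; apply/on_stripP; exists b, i. Qed.

Lemma strip_rail_sym n f b i : strip n f -> i.+1 < n -> e (f b i.+1) (f b i).
Proof. by move=> sf lt_i; rewrite e_sym (strip_rail sf). Qed.

Lemma strip_swap n f : strip n f -> strip n (fun b => f (~~ b)).
Proof.
case=> rung rail sE; split=> [b i /rung//|b i /rail//|b c i j li lj].
by rewrite sE // (inj_eq negb_inj).
Qed.

Lemma strip_rev n f : strip n.+1 f -> strip n.+1 (fun b i => f b (n - i)).
Proof.
case=> rung rail sE; split=> [b i li|b i li|b c i j li lj].
- by apply: rung; rewrite ltnS leq_subr.
- by rewrite e_sym -(subnSK (li : i < n)) rail // (subnSK (li : i < n)) ltnS leq_subr.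
by rewrite sE ?ltnS ?leq_subr //; congr (_ && _); lia.
Qed.

Lemma strip_interior n f b i x : strip n f -> i.+2 < n -> e (f b i.+1) x ->
  x \in [:: f b i; f b i.+2; f (~~ b) i.+1].
Proof.
move=> sf li; apply: cubic_neighbours.
- by rewrite /= !inE !(strip_eq sf); lia.
- by rewrite (strip_rail_sym _ sf) // ltnW.
- exact: (strip_rail sf).
- by apply: (strip_rung sf); rewrite ltnW.
Qed.

Lemma strip_interior_on n f b i x :
  strip n f -> i.+2 < n -> e (f b i.+1) x -> on_stripb n f x.
Proof.
move=> sf li /(strip_interior sf li); rewrite !inE => /or3P[] /eqP->;
  by apply: on_strip_vertex; lia.
Qed.

Lemma strip_append n f x y : strip n.+1 f ->
    ~~ on_stripb n.+1 f x -> ~~ on_stripb n.+1 f y ->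
    e (f false n) x -> e (f true n) y -> e x y ->
  exists g, strip n.+2 g.
Proof.
move=> sf nx ny ax by' xy.
exists (fun b i => if i == n.+1 then if b then y else x else f b i).
have off b i : i < n.+1 -> (f b i == x = false) * (f b i == y = false)
    * (x == f b i = false) * (y == f b i = false).
  move=> li; do !split; apply/negbTE;
    by [apply: contraNneq nx => <-; apply: on_strip_vertex
       |apply: contraNneq ny => <-; apply: on_strip_vertex
       |apply: contraNneq nx => ->; apply: on_strip_vertex
       |apply: contraNneq ny => ->; apply: on_strip_vertex].
have nxy : x == y = false by apply/negbTE; apply: contraTneq xy => ->; rewrite e_irr.
split=> [b i li|b i li|b c i j li lj].
- case: eqP => [_|/eqP ni]; first by case: b; rewrite // e_sym.
  by apply: (strip_rung sf); lia.
- rewrite ltn_eqF // eqSS; case: eqP => [->|/eqP ni]; first by case: b.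
  by apply: (strip_rail sf); lia.
have [iE|ni] := eqVneq i n.+1; have [jE|nj] := eqVneq j n.+1.
- by rewrite iE jE eqxx andbT; case: b; case: c; rewrite ?eqxx ?nxy // eq_sym nxy.
- by rewrite iE [n.+1 == j]eq_sym (negbTE nj) andbF; case: b; rewrite off //; lia.
- by rewrite jE (negbTE ni) andbF; case: c; rewrite off //; lia.
by apply: (strip_eq sf); lia.
Qed.

(** * Prolonging a strip *)

Hypothesis e_sober : sober e.
Hypothesis e_squares : every_edge_in_square e.

(** If [z] is off the strip, [x] and [z] form the next rung. Otherwise [z] lies on the first rung,
    since inner vertices have no neighbour off the strip. *)
Lemma strip_append_square n f x z : strip n.+2 f -> ~~ on_stripb n.+2 f x ->
    e (f false n.+1) x -> e x z -> e z (f true n.+1) -> z != f false n.+1 ->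
  exists g, strip n.+3 g.
Proof.
move=> sf nx ax xz zb nza.
suff nz : ~~ on_stripb n.+2 f z by apply: (strip_append sf nx nz) => //;
  rewrite e_sym.
have xoff b i : i < n.+2 -> (f b i == x) = false.
  by move=> li; apply/negbTE; apply: contraNneq nx => <-; apply: on_strip_vertex.
apply/negP=> /on_stripP[c [[|j] lj zE]]; last first.
  have [lj'|] := ltnP j.+2 n.+2.
    by case/negP: nx; rewrite (strip_interior_on (b := c) sf lj') // -zE e_sym.
  rewrite leq_eqVlt ltnNge lj orbF eqSS => /eqP[jE].
  rewrite -{}jE {lj} in zE; case: c zE => zE; last by rewrite zE eqxx in nza.
  by rewrite zE e_irr in zb.
have zx : e z x by rewrite e_sym.
have z1 : e z (f c 1) by rewrite zE (strip_rail sf).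
have zr : e z (f (~~ c) 0) by rewrite zE (strip_rung sf).
(* Among the neighbours [x], [f true n.+1], [f c 1], [f (~~ c) 0] of [z], only the second and third
   can coincide. *)
have [n0|[n0 cT]] : f true n.+1 != f c 1 \/ n = 0 /\ c = true.
- by rewrite (strip_eq sf) //; case: n {sf nx ax zb nza zE lj z1 zr xoff} c => [|n] []; auto.
- apply: (cubic_no4 _ zx zb z1 zr);
    rewrite /= !inE !negb_or n0 ![x == _]eq_sym !xoff //=.
  by rewrite !(strip_eq sf) //; lia.
rewrite n0 cT in zE sf ax xoff z1 zr lj zb nx *.
(* On two rungs, both vertices are adjacent to [x], [f true 1] and [f false 0], against
   soberness. *)
suff /eqP: f false 1 = f true 0 by rewrite (strip_eq sf).
apply: e_sober; apply: star_sub_eq => //; apply/subsetP=> y; rewrite !in_star => ay.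
have : y \in [:: x; f true 1; f false 0].
  apply: (cubic_neighbours _ ax _ _ ay).
  - by rewrite /= !inE !negb_or ![x == _]eq_sym !xoff // !(strip_eq sf).
  - exact: (strip_rung sf).
  - exact: (strip_rail_sym _ sf).
by rewrite -zE !inE => /or3P[] /eqP->.
Qed.

Lemma on_strip_rev n f x :
  on_stripb n.+1 f x -> on_stripb n.+1 (fun b i => f b (n - i)) x.
Proof.
case/on_stripP=> b [i li ->]; apply/on_stripP; exists b, (n - i); first lia.
by rewrite subKn.
Qed.

Lemma on_strip_swap n f x :
  on_stripb n f x -> on_stripb n (fun b => f (~~ b)) x.
Proof.
by case/on_stripP=> b [i li ->]; apply/on_stripP; exists (~~ b), i; rewrite ?negbK.
Qed.

(** Rungs and rails of the square change roles while [f false 1] keeps its place; [~~ b] is read as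
    a number. *)
Lemma strip2_transpose f : strip 2 f -> strip 2 (fun b i => f (i == 0) (~~ b)).
Proof.
move=> sf; split=> [b i li|b i li|b c i j li lj].
- by case: b; rewrite /= ?(strip_rail sf) // (strip_rail_sym _ sf).
- by case: i li => // _; apply: (strip_rung sf); case: b.
by rewrite (strip_eq sf); case: b c i j li lj => [] [] [|[|i]] [|[|j]].
Qed.

(* As in the cube, [x] completes a square with one rail of the strip; the third
   neighbour of [x] then prolongs one of the two ends. *)
Lemma strip3_append f x : strip 3 f -> ~~ on_stripb 3 f x ->
  e (f false 2) x -> e (f false 0) x -> exists g, strip 4 g.
Proof.
move=> sf nx v2x v0x.
have x2 : e x (f false 2) by rewrite e_sym.
have x0 : e x (f false 0) by rewrite e_sym.
have [z [xz z0 z2]] := cubic_third x (f false 0) (f false 2).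
have [t [s /andP[/and5P[_ zt ts sx _]]]] := e_squares xz.
rewrite /= !inE !negb_or => /and4P[/and3P[_ nxt nxs] /andP[nzt nzs] nts _].
(* The vertex [s] will be an end of the rail, and reversal puts it at [h false 2]. If [t] is
   [h false 1], then [z] is the inner vertex [h true 1], which cannot be adjacent to [x]; if [t] is
   [h true 2], the square prolongs the strip. *)
have corner h : strip 3 h -> ~~ on_stripb 3 h x -> e (h false 2) x ->
    z != h false 0 -> z != h false 2 -> s = h false 2 -> exists g, strip 4 g.
  move=> sh nhx h2x zh0 zh2 sE; rewrite {}sE in ts sx nxs nzs nts.
  have ht : e (h false 2) t by rewrite e_sym.
  have off b i : i < 3 -> (h b i == x) = false.
    by move=> li; apply/negbTE; apply: contraNneq nhx => <-; apply: on_strip_vertex.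
  have : t \in [:: x; h false 1; h true 2].
    apply: (cubic_neighbours _ h2x _ _ ht).
    - by rewrite /= !inE !negb_or ![x == _]eq_sym !off // !(strip_eq sh).
    - exact: (strip_rail_sym _ sh).
    - exact: (strip_rung sh).
  rewrite !inE eq_sym (negbTE nxt) /= => /orP[]/eqP tE; rewrite tE in zt.
    rewrite e_sym in zt.
    have := strip_interior sh (isT : 2 < 3) zt.
    rewrite !inE (negbTE zh0) (negbTE zh2) /= => /eqP zE.
    case/negP: nhx; apply: (strip_interior_on (b := true) (i := 0) sh) => //.
    by rewrite -zE e_sym.
  exact: (strip_append_square sh nhx h2x xz zt zh2).
have xs : e x s by rewrite e_sym.
have : s \in [:: f false 0; f false 2; z].
  apply: (cubic_neighbours _ x0 x2 xz xs).
  by rewrite /= !inE !negb_or (strip_eq sf) // ![_ == z]eq_sym z0 z2.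
rewrite !inE [s == z]eq_sym (negbTE nzs) orbF => /orP[]/eqP sE.
  apply: (corner _ (strip_rev sf)) => //.
  by apply: contra nx => /on_strip_rev/on_stripP[b [i li ->]];
    rewrite subKn //; apply: on_strip_vertex.
exact: (corner f).
Qed.

Lemma strip_extend_end n f x : strip n.+2 f -> ~~ on_stripb n.+2 f x ->
  e (f false n.+1) x -> exists g, strip n.+3 g.
Proof.
move=> sf nx ax; have [z [t /andP[/and5P[_ xz zt ta _]]]] := e_squares ax.
rewrite /= !inE !negb_or => /and4P[/and3P[_ naz nat] /andP[nxz nxt] nzt _].
have at_ : e (f false n.+1) t by rewrite e_sym.
have xoff b i : i < n.+2 -> (f b i == x) = false.
  by move=> li; apply/negbTE; apply: contraNneq nx => <-; apply: on_strip_vertex.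
have : t \in [:: x; f true n.+1; f false n].
  apply: (cubic_neighbours _ ax _ _ at_).
  - by rewrite /= !inE !negb_or ![x == _]eq_sym !xoff // !(strip_eq sf) //; lia.
  - exact: (strip_rung sf).
  - exact: (strip_rail_sym _ sf).
rewrite !inE eq_sym (negbTE nxt) /= => /orP[]/eqP tE; rewrite tE in zt.
  by apply: (strip_append_square sf nx ax xz zt); rewrite eq_sym.
(* Now [t] is the rail neighbour. With two rungs, transposition makes it the rung partner. With
   more, [t] is inner, so [z] is on the strip; being adjacent to [x], it must be [f false 0] on
   three rungs. *)
case: n => [|m] in sf nx ax naz nat ta at_ xoff zt tE *.
  apply: (strip_append_square (strip2_transpose sf) _ ax xz zt);
    last by rewrite eq_sym.
  apply: contra nx => /on_stripP[b [i li ->]]; apply: on_strip_vertex; by case: b.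
have := strip_interior sf (ltnSn _) (_ : e (f false m.+1) z); rewrite e_sym zt.
move=> /(_ isT); rewrite !inE [z == f false _.+2]eq_sym (negbTE naz) /= => /orP[]/eqP zE.
  case: m => [|m] in sf nx ax naz nat ta at_ xoff zt tE zE *.
    by apply: (strip3_append sf nx ax); rewrite -zE e_sym.
  case/negP: nx; apply: (strip_interior_on (b := false) (i := m) sf) => //.
  by rewrite -zE e_sym.
case/negP: nx; apply: (strip_interior_on (b := true) (i := m) sf) => //.
by rewrite -zE e_sym.
Qed.

(** Edges leave only at the four corners, and swapping and reversing bring each of them to
    [f false n.+1]. *)
Lemma strip_extend n f b i x : strip n.+2 f -> ~~ on_stripb n.+2 f x ->
  i < n.+2 -> e (f b i) x -> exists g, strip n.+3 g.
Proof.
move=> sf nx li bx.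
have nswap h : strip n.+2 h -> ~~ on_stripb n.+2 h x -> forall c, e (h c n.+1) x ->
    exists g, strip n.+3 g.
  move=> sh nhx [] hx; last exact: strip_extend_end sh nhx hx.
  apply: (strip_extend_end (strip_swap sh) _ hx).
  apply: contra nhx => /on_strip_swap/on_stripP[c [j lj ->]].
  by rewrite negbK; apply: on_strip_vertex.
case: i => [|i] in li bx *.
  apply: (nswap _ (strip_rev sf) _ b); last by rewrite subnn.
  apply: contra nx => /on_strip_rev/on_stripP[c [j lj ->]].
  by rewrite subKn //; apply: on_strip_vertex.
have [li'|] := ltnP i.+2 n.+2.
  by case/negP: nx; apply: (strip_interior_on sf li' bx).
move=> ge_i; have iE : i = n by lia.
by rewrite iE in bx; apply: (nswap f sf nx b).
Qed.

Lemma strip_card n f : strip n f -> 2 * n <= #|V|.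
Proof.
move=> sf; rewrite -card_bool -[n in X in X <= _]card_ord -card_prod.
apply: (@leq_card _ _ (fun p : bool * 'I_n => f p.1 p.2)) => -[b i] [c j] /eqP.
by rewrite (strip_eq sf) //= => /andP[/eqP-> /eqP/val_inj->].
Qed.

Lemma strip2_exists (v : V) : exists f, strip 2 f.
Proof.
have [x [vx _ _]] := cubic_third v v v.
have [z [t /andP[/and5P[_ xz zt tv _]]]] := e_squares vx.
rewrite /= !inE !negb_or => /and4P[/and3P[nvx nvz nvt] /andP[nxz nxt] nzt _].
exists (fun b i => if b then if i == 0 then t else z else if i == 0 then v else x).
split.
- by case=> [] [|[|i]] //= _; rewrite // e_sym.
- by case=> [] [|i] //= _; rewrite // e_sym.
by case=> [] [] [|[|i]] [|[|j]] //= _ _; apply/eqP; rewrite ?eqxx //; apply/eqP=> //;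
  rewrite eq_sym.
Qed.

(** * Covering strips and the classification *)

Hypothesis e_conn : connected e.

Lemma covering_strip (v : V) :
  exists n f, strip n.+2 f /\ forall x, on_stripb n.+2 f x.
Proof.
have [f0 sf0] := strip2_exists v.
(* The number [k] bounds the remaining prolongations; at 0 the strip would outgrow the graph. *)
have main k : forall n f, strip n.+2 f -> #|V| <= n + k ->
    exists n f, strip n.+2 f /\ forall x, on_stripb n.+2 f x.
  elim: k => [|k IHk] n f sf le_V; first by have := strip_card sf; lia.
  have [/forallP all_on|] := boolP [forall x, on_stripb n.+2 f x];
    first by exists n, f.
  move=> nall.
  have [b [i [x [li bx nx]]]] : exists b i x, [/\ i < n.+2, e (f b i) x & ~~ on_stripb n.+2 f x].
    have [/existsP[y /andP[/on_stripP[b [i li ->]] /existsP[x /andP[bx nx]]]]|no] :=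
      boolP [exists y, on_stripb n.+2 f y && [exists x, e y x && ~~ on_stripb n.+2 f x]].
      by exists b, i, x.
    case/negP: nall; apply/forallP=> x.
    (* If no edge leaves the strip, connectedness makes it the whole graph. *)
    have cl : closed e (on_stripb n.+2 f).
      apply: intro_closed; first exact: sym_connect_sym.
      move=> y z yz yon; apply: contraR no => zoff; apply/existsP; exists y.
      by apply/andP; split=> //; apply/existsP; exists z; rewrite yz.
    have <- : (f false 0 \in on_stripb n.+2 f) = on_stripb n.+2 f x.
      exact: (closed_connect cl (e_conn (f false 0) x)).
    exact: on_strip_vertex.
  have [g sg] := strip_extend sf nx li bx; apply: (IHk n.+1 g sg).
  by rewrite addSnnS.
exact: (main #|V| 0 f0 sf0).
Qed.

(** The third neighbour of an end vertex is not inner, since the neighbours of inner vertices are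
    already known, nor on the last rung. *)
Lemma strip_end_edge n f : strip n.+3 f -> (forall x, on_stripb n.+3 f x) ->
  forall b, exists c, e (f b n.+2) (f c 0).
Proof.
move=> sf all_on b.
have [z [bz z1 z2]] := cubic_third (f b n.+2) (f b n.+1) (f (~~ b) n.+2).
have /on_stripP[c [[|i] li zE]] := all_on z; first by exists c; rewrite -zE.
have [li'|ge_i] := ltnP i.+2 n.+3.
  have : e (f c i.+1) (f b n.+2) by rewrite -zE e_sym.
  move/(strip_interior sf li'); rewrite !inE !(strip_eq sf) ?ltnS //; last by lia.
  move=> h; have [bc iE] : c = b /\ i = n by move: h; case: (b);
    case: (c) => /=; lia.
  by rewrite zE bc iE eqxx in z1.
have iE : i.+1 = n.+2 by lia.
rewrite {}iE in zE; have [bc|bc] := eqVneq c b; first by rewrite zE bc e_irr in bz.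
have cE : c = ~~ b by move: bc; case: (b); case: (c).
by rewrite zE cE eqxx in z2.
Qed.

(** A common end of both closing edges would have four neighbours; and an injective map of booleans
    adds a constant [t]. *)
Lemma strip_closing n f : strip n.+3 f -> (forall x, on_stripb n.+3 f x) ->
  exists t, forall b, e (f b n.+2) (f (b (+) t) 0).
Proof.
move=> sf all_on; have edge := strip_end_edge sf all_on.
have [c fc] := edge false; have [d td] := edge true.
have [cd|cd] := eqVneq c d; last first.
  by exists c; case; rewrite //=; have -> : ~~ c = d by move: cd; case: (c);
    case: (d).
rewrite -{}cd in td; exfalso.
apply: (@cubic_no4 (f c 0) (f c 1) (f (~~ c) 0) (f false n.+2) (f true n.+2)).
- by rewrite /= !inE !(strip_eq sf); case: (c).
- exact: (strip_rail sf).
- exact: (strip_rung sf).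
- by rewrite e_sym.
- by rewrite e_sym.
Qed.

(** The strip is a bijective homomorphism; both graphs being cubic, it maps stars onto stars. *)
Lemma strip_ladder_iso n f t : strip n.+3 f -> (forall x, on_stripb n.+3 f x) ->
    (forall b, e (f b n.+2) (f (b (+) t) 0)) ->
  graph_iso (@ladder n.+3 t) e.
Proof.
move=> sf all_on close.
pose phi (p : bool * 'I_n.+3) := f p.1 p.2.
have phi_inj : injective phi.
  move=> [b i] [c j] /eqP; rewrite /phi (strip_eq sf) //= => /andP[/eqP-> /eqP ij].
  by congr (_, _); apply: val_inj.
have sub : subrel (ladder t) (relpre phi e).
  have sub1 (p q : bool * 'I_n.+3) : [|| rail p q, rung p q | closing t p q] -> e (phi p) (phi q).
    case: p q => b i [c j]; rewrite /phi /=; case/or3P.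
    - by case/andP=> /= /eqP<- /eqP ji; rewrite ji (strip_rail sf) // -ji.
    - by case/and3P=> /=; case: b => // _; case: c => // _ /eqP<-;
        apply: (strip_rung sf false).
    by case/and3P=> /= /eqP-> /eqP[->] /eqP->.
  by move=> p q /orP[/sub1//|/sub1]; rewrite /= e_sym.
exists phi.
  apply: inj_card_bij => //; rewrite -(card_codom phi_inj).
  apply/subset_leq_card/subsetP=> x _; have /existsP[p /eqP->] := all_on x.
  exact: codom_f.
move=> p q; rewrite -!in_star.
have <- : phi @: star (ladder t) p = star e (phi p).
  apply/eqP; rewrite eqEcard card_imset // e_cubic ladder_cubic // leqnn andbT.
  by apply/subsetP=> _ /imsetP[r + ->]; rewrite !in_star => /sub.
exact: mem_imset.
Qed.

(** With a twist, [f false 0] and [f true 1] would have the same star, as in $K_{3,3}$. *)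
Lemma strip3_untwisted f t : strip 3 f ->
  (forall b, e (f b 2) (f (b (+) t) 0)) -> t = false.
Proof.
move=> sf close; apply/negbTE/negP=> tT; rewrite tT in close.
suff /eqP : f false 0 = f true 1 by rewrite (strip_eq sf).
apply: e_sober; apply: star_sub_eq => //; apply/subsetP=> y; rewrite !in_star => vy.
have : y \in [:: f false 1; f true 0; f true 2].
  apply: (cubic_neighbours _ _ _ _ vy).
  - by rewrite /= !inE !(strip_eq sf).
  - exact: (strip_rail sf).
  - exact: (strip_rung sf).
  - by rewrite e_sym (close true).
rewrite !inE => /or3P[] /eqP->.
- exact: (strip_rung sf).
- exact: (strip_rail_sym _ sf).
- exact: (strip_rail sf).
Qed.

Lemma strip2_complete f : (forall x, on_stripb 2 f x) -> strip 2 f ->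
  graph_iso e (complete_graph 4).
Proof.
move=> all_on sf.
have cV : #|V| = 4.
  apply/eqP; rewrite eqn_leq (strip_card sf) andbT.
  have -> : 4 = #|{: bool * 'I_2}| by rewrite card_prod card_bool card_ord.
  apply: (leq_trans _ (leq_image_card (fun p : bool * 'I_2 => f p.1 p.2) predT)).
  apply/subset_leq_card/subsetP=> x _; have /existsP[p /eqP->] := all_on x.
  exact: image_f.
exists (cast_ord cV \o enum_rank).
  exact: (bij_comp (Bijective (cast_ordK cV) (cast_ordKV cV)) (@enum_rank_bij V)).
move=> x y; rewrite /complete_graph /= (inj_eq (can_inj (cast_ordK cV))) (inj_eq enum_rank_inj).
have /setP/(_ y) : star e x = [set~ x].
  apply/eqP; rewrite eqEcard e_cubic; apply/andP; split.
    by apply/subsetP=> z; rewrite !inE; apply: contraTneq => ->; rewrite e_irr.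
  by rewrite -(leq_add2l #|[set x]|) cardsC cV cards1.
by rewrite in_star !inE eq_sym => ->.
Qed.

Lemma squares_ladder (v : V) :
  [\/ graph_iso e (complete_graph 4),
      exists2 n, 3 <= n & graph_iso e (Hgraph n)
    | exists2 n, 4 <= n & graph_iso e (Htgraph n)].
Proof.
have [[|n] [f [sf all_on]]] := covering_strip v.
  by apply: Or31; apply: strip2_complete sf.
have [t close] := strip_closing sf all_on.
have iso := graph_iso_sym (strip_ladder_iso sf all_on close).
case: t => [|] in close iso.
  apply: Or33; exists n.+3 => //; case: n => [|n] in sf all_on close iso * => //.
  by have := strip3_untwisted sf close.
by apply: Or32; exists n.+3.
Qed.

End Strips.

Theorem theorem7p5 (V : finType) (e : rel V)
    (e_sym : symmetric e) (e_irr : irreflexive e)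
    (e_cubic : cubic e) (e_conn : connected e) :
  [<-> (* (i) *) jordan_dedekind (Fl e);
       (* (ii) *) c_rk e <= 3 \/ sober e /\ every_edge_in_square e;
       (* (iii) *)
       [\/ c_rk e <= 3,
           graph_iso e (complete_graph 4),
           exists2 n, 3 <= n & graph_iso e (Hgraph n)
         | exists2 n, 4 <= n & graph_iso e (Htgraph n)]].
Proof.
(* The empty graph is treated apart: the lemmas on squares start from a vertex. *)
have [V0|[v _]] := set_0Vmem [set: V].
  have rk : c_rk e <= 3.
    apply/bigmax_leqP=> W _; rewrite (leq_trans (subset_leq_card (subsetT W))) //.
    by rewrite V0 cards0.
  by tfae=> _; [left | apply: Or41 | apply: c_rk_le3_jordan_dedekind].
tfae.
- exact: jordan_dedekind_c_rk_or_squares.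
- case=> [rk|[sob sq]]; first exact: Or41.
  have [K4|H|Ht] := squares_ladder e_sym e_irr e_cubic sob sq e_conn v.
  + exact: Or42.
  + exact: Or43.
  + exact: Or44.
have jd (U : finType) (e' : rel U) : sober e' -> every_edge_in_square e' ->
    graph_iso e e' -> jordan_dedekind (Fl e).
  move=> sob sq iso; apply: squares_jordan_dedekind => //.
    exact: graph_iso_sober iso sob.
  exact: graph_iso_squares iso sq.
case=> [rk|iso|[[|n] // n_ge3 iso]|[[|n] // n_ge4 iso]].
- exact: c_rk_le3_jordan_dedekind.
- exact: jd complete_graph4_sober complete_graph4_squares iso.
- by apply: jd iso; [apply: ladder_sober | apply: ladder_squares].
have n_ge2 : 2 <= n by apply: ltnW.
by apply: jd iso; [apply: ladder_sober | apply: ladder_squares].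
Qed.
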